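(* Let $H$, $N$, $m$, $\Omega_{N0}$, $\Omega_{m0}$, $H_p$, $H_e$ and the time derivative $\frac{d}{dt}$ be as defined in the context. (1) (Particle horizon.) Suppose $N>2$. Then $$\lim_{z\to\infty}H_p(z)=0,\qquad \lim_{z\to-1^+}H_p(z)=\infty,$$ $$\lim_{z\to\infty}\frac{dH_p}{dt}(z)=\frac{N}{N-2},\qquad \lim_{z\to-1^+}\frac{dH_p}{dt}(z)=\begin{cases}\infty & \text{if } m\le 2,\\ \dfrac{m}{m-2} & \text{if } m>2.\end{cases}$$ (2) (Event horizon.) Suppose $m<2$. Then $$\lim_{z\to\infty}H_e(z)=\begin{cases}0&\text{if }N>0,\\ \dfrac1{H_0\sqrt{\Omega_{N0}}}&\text{if }N=0,\\ \infty&\text{if }N<0,\end{cases}\qquad \lim_{z\to-1^+}H_e(z)=\begin{cases}0&\text{if }m<0,\\ \dfrac1{H_0\sqrt{\Omega_{m0}}}&\text{if }m=0,\\ \infty&\text{if }m>0,\end{cases}$$ $$\lim_{z\to\infty}\frac{dH_e}{dt}(z)=\begin{cases}\infty&\text{if }N\ge2,\\ \dfrac{N}{2-N}&\text{if }N<2,\end{cases}\qquad \lim_{z\to-1^+}\frac{dH_e}{dt}(z)=\frac{m}{2-m}.$$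
   Context: Units are $c=G=1$. Let $H_0>0$, let $(n_i)_{i\ge 1}$ be real constants and $(\Omega_{i0})_{i\ge1}$ real constants with $\sum_{i=1}^\infty\Omega_{i0}=1$ (convergent series). Here $n_i=3(1+w_i)$, where $p_i=w_i\rho_i$ is the $i$-th state equation. The curvature is included as one of the components, so $\Omega_{i0}$ may be negative. The case of finitely many state equations is obtained by taking all but finitely many $\Omega_{i0}$ equal to $0$. Different state equations have different exponents: the $n_i$ with $\Omega_{i0}\neq 0$ are pairwise distinct. Put $S_n(z)=\sum_{i=1}^n\Omega_{i0}(1+z)^{n_i}$ for $z>-1$. Standing hypotheses: - The derivatives $S_n'$ converge uniformly on $(-1,\infty)$ to a function $G$, i.e. $\sup_{z>-1}|S_n'(z)-G(z)|\to0$ as $n\to\infty$. - The universe is expanding: $\sum_{i=1}^\infty\Omega_{i0}(1+z)^{n_i}>0$ for all $z>-1$. The Hubble parameter as a function of the redshift $z$ is $$H(z)=H_0\sqrt{\sum_{i=1}^\infty\Omega_{i0}(1+z)^{n_i}}>0,\qquad z>-1.$$ $N$ and $m$ denote respectively the largest and the smallest of the exponents $n_i$ that appear in $H$ (i.e. with $\Omega_{i0}\ne0$), and $\Omega_{N0}$, $\Omega_{m0}$ denote the corresponding coefficients $\Omega_{i0}$. The particle horizon and event horizon at redshift $z>-1$ are $$H_p(z)=\frac1{1+z}\int_z^\infty\frac{dx}{H(x)},\qquad H_e(z)=\frac1{1+z}\int_{-1}^z\frac{dx}{H(x)};$$ $H_p$ is finite on $(-1,\infty)$ when $N>2$, and $H_e$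 is finite on $(-1,\infty)$ when $m<2$. Redshift and cosmic time $t$ are related by $\frac{dz}{dt}=-(1+z)H(z)$. For a differentiable function $X(z)$ of redshift, its time derivative at the moment of redshift $z$ is accordingly $\frac{dX}{dt}(z)=-(1+z)H(z)X'(z)$. The limit $z\to\infty$ corresponds to the origin of the universe and $z\to-1^+$ to the far future. *)

(* Defs.v *)
From Stdlib Require Export Reals.
From Coquelicot Require Export Coquelicot.
Open Scope R_scope.

(* The components are indexed by i = 0, 1, 2, ... instead of i >= 1:
   Omega i is the present density parameter (possibly negative or zero) and
   n i the exponent of the i-th component.  Note that [sum_n a k] is
   a 0 + ... + a k. *)
Definition density_term (Omega n : nat -> R) (z : R) (i : nat) : R :=
  Omega i * Rpower (1 + z) (n i).

Definition density_partial (Omega n : nat -> R) (k : nat) (z : R) : R :=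
  sum_n (density_term Omega n z) k.

Definition density (Omega n : nat -> R) (z : R) : R :=
  Series (density_term Omega n z).

Definition converges_uniformly_on
  (D : R -> Prop) (f : nat -> R -> R) (g : R -> R) : Prop :=
  forall eps : posreal,
    eventually (fun k => forall z, D z -> Rabs (f k z - g z) < eps).

(* Components with Omega i = 0 are absent; their exponents are irrelevant. *)
Definition distinct_exponents (Omega n : nat -> R) : Prop :=
  forall i j, Omega i <> 0 -> Omega j <> 0 -> n i = n j -> i = j.

(* The distinguished component is given by its index, so that both its
   exponent n i and its coefficient Omega i can be referred to. *)
Definition largest_exponent_at (Omega n : nat -> R) (i : nat) : Prop :=
  Omega i <> 0 /\ forall j, Omega j <> 0 -> n j <= n i.

Definition smallest_exponent_at (Omega n : nat -> R) (i : nat) : Prop :=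
  Omega i <> 0 /\ forall j, Omega j <> 0 -> n i <= n j.

Definition hubble (H0 : R) (Omega n : nat -> R) (z : R) : R :=
  H0 * sqrt (density Omega n z).

(* [RInt_gen] is total; it is the improper integral only where [ex_RInt_gen]
   holds. *)
Definition particle_horizon_finite (H : R -> R) (z : R) : Prop :=
  ex_RInt_gen (fun x => / H x) (at_point z) (Rbar_locally p_infty).

Definition particle_horizon (H : R -> R) (z : R) : R :=
  / (1 + z) * RInt_gen (fun x => / H x) (at_point z) (Rbar_locally p_infty).

Definition event_horizon_finite (H : R -> R) (z : R) : Prop :=
  ex_RInt_gen (fun x => / H x) (at_right (-1)) (at_point z).

Definition event_horizon (H : R -> R) (z : R) : R :=
  / (1 + z) * RInt_gen (fun x => / H x) (at_right (-1)) (at_point z).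

(* d/dt in terms of the redshift, from dz/dt = - (1 + z) H(z). *)
Definition time_derivative (H X : R -> R) (z : R) : R :=
  - (1 + z) * H z * Derive X z.

(* z -> -1+ is the far future, z -> +oo the origin of the universe. *)
Definition lim_future (f : R -> R) (l : Rbar) : Prop :=
  filterlim f (at_right (-1)) (Rbar_locally l).

Definition lim_origin (f : R -> R) (l : Rbar) : Prop :=
  is_lim f p_infty l.

(* Main.v *)
Require Import Defs.
From Stdlib Require Import Lra Lia Classical.

(** Consecutive partial sums have derivatives differing by the single term
    Omega_i n_i (1+z)^(n_i - 1); uniform convergence makes it bounded on (-1, oo) for
    large i, which forces n_i = 1 or n_i = 0.  As exponents are distinct, only finitely
    many components are present, and H is governed by N at the origin and by m in the
    far future.

    With t = ln (1+z) and K = (1+z) / H we have dz / H = K dt, so that for a primitive A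
    of K the horizons are (A(oo) - A) e^(-t) and (A - A(-oo)) e^(-t), and their time
    derivatives are 1 + (A(oo) - A) / K and -1 + (A - A(-oo)) / K.  Since K is asymptotic
    to c e^(lam t) with lam = 1 - N/2, l'Hopital's rule against e^(lam t) gives the limits
    at t -> oo; the reflection t -> -t, under which lam becomes m/2 - 1, gives those at
    t -> -oo. *)

(** * L'Hopital's rule at infinity, from monotonicity *)

Lemma nondecreasing_of_derive_nonneg (f df : R -> R) (a : R) :
  (forall x, is_derive f x (df x)) -> (forall x, a <= x -> 0 <= df x) ->
  forall x y, a <= x -> x <= y -> f x <= f y.
Proof.
  intros Hd Hpos x y Hax Hxy.
  destruct (MVT_gen f x y df) as [c [Hc Heq]].
  - intros; apply Hd.
  - intros z _; apply continuity_pt_filterlim, (ex_derive_continuous f).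
    now exists (df z).
  - rewrite Rmin_left, Rmax_right in Hc by lra.
    assert (0 <= df c) by (apply Hpos; lra). nra.
Qed.

(** Once [r] is within [e] of [L], the derivative of either difference is a nonnegative multiple of
    [g']. Stated as monotonicity, this serves both the infinite and the zero form of the rule. *)
Lemma lhopital_sandwich (f g g' r : R -> R) (L e : R) :
  (forall x, is_derive f x (r x * g' x)) -> (forall x, is_derive g x (g' x)) ->
  (forall x, 0 <= g' x) -> is_lim r p_infty L -> 0 < e ->
  exists a, forall x y, a <= x -> x <= y ->
    f x - (L - e) * g x <= f y - (L - e) * g y /\
    (L + e) * g x - f x <= (L + e) * g y - f y.
Proof.
  intros Hf Hg Hg' Hr He.
  destruct (proj2 (is_lim_spec r p_infty L) Hr (mkposreal e He)) as [M HM]; simpl in HM.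
  (* The limit controls [r] only for [t > M]; the shift by 1 yields a closed half-line. *)
  exists (M + 1); intros x y Hx Hxy.
  assert (Hr2 : forall t, M + 1 <= t -> L - e < r t < L + e).
  { intros t Ht. specialize (HM t ltac:(lra)). apply Rabs_def2 in HM. lra. }
  split.
  - apply (nondecreasing_of_derive_nonneg (fun t => f t - (L - e) * g t)
             (fun t => (r t - (L - e)) * g' t) (M + 1)); trivial.
    + intros t. replace ((r t - (L - e)) * g' t) with (r t * g' t - (L - e) * g' t) by ring.
      apply (is_derive_minus f (fun t => (L - e) * g t)); [apply Hf|].
      apply (is_derive_scal g), Hg.
    + intros t Ht. specialize (Hr2 t Ht). apply Rmult_le_pos; [lra|apply Hg'].
  - apply (nondecreasing_of_derive_nonneg (fun t => (L + e) * g t - f t)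
             (fun t => (L + e - r t) * g' t) (M + 1)); trivial.
    + intros t. replace ((L + e - r t) * g' t) with ((L + e) * g' t - r t * g' t) by ring.
      apply (is_derive_minus (fun t => (L + e) * g t) f); [|apply Hf].
      apply (is_derive_scal g), Hg.
    + intros t Ht. specialize (Hr2 t Ht). apply Rmult_le_pos; [lra|apply Hg'].
Qed.

(** The sandwich from [a] to [x] gives [(L - eps/2) g x + C1 <= f x <= (L + eps/2) g x - C2], and
    [g] eventually absorbs the constants. *)
Lemma lhopital_infinity (f g g' r : R -> R) (L : R) :
  (forall x, is_derive f x (r x * g' x)) -> (forall x, is_derive g x (g' x)) ->
  (forall x, 0 <= g' x) -> is_lim r p_infty L -> is_lim g p_infty p_infty ->
  is_lim (fun x => f x / g x) p_infty L.
Proof.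
  intros Hf Hg Hg' Hr Hgl. apply is_lim_spec; intros [eps Heps]; simpl.
  assert (He : 0 < eps / 2) by lra.
  destruct (lhopital_sandwich f g g' r L _ Hf Hg Hg' Hr He) as [a Ha].
  set (C1 := f a - (L - eps / 2) * g a) in *.
  set (C2 := (L + eps / 2) * g a - f a) in *.
  (* Beyond this threshold [(eps / 2) * g x] exceeds [|C1| + |C2|], which uses up the other half of
     [eps]. *)
  destruct (proj2 (is_lim_spec g p_infty p_infty) Hgl
              ((Rabs C1 + Rabs C2) / (eps / 2))) as [M HM].
  exists (Rmax a M); intros x Hx.
  assert (a < x) by (eapply Rle_lt_trans; [apply Rmax_l|exact Hx]).
  assert (M < x) by (eapply Rle_lt_trans; [apply Rmax_r|exact Hx]).
  specialize (HM x H0). specialize (Ha a x (Rle_refl a) (Rlt_le _ _ H)).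
  fold C1 C2 in Ha.
  apply (Rmult_lt_compat_r (eps / 2)) in HM; [|exact He].
  unfold Rdiv at 1 in HM; rewrite Rmult_assoc, Rinv_l, Rmult_1_r in HM by lra.
  pose proof (Rabs_pos C1). pose proof (Rabs_pos C2).
  pose proof (Rle_abs (- C1)). pose proof (Rle_abs (- C2)). rewrite Rabs_Ropp in *.
  assert (Hgx : 0 < g x) by nra.
  replace (f x / g x - L) with ((f x - L * g x) / g x) by (field; lra).
  unfold Rdiv; rewrite Rabs_mult, (Rabs_right (/ g x)).
  2: apply Rle_ge, Rlt_le, Rinv_0_lt_compat, Hgx.
  apply (Rmult_lt_reg_r (g x)); [exact Hgx|].
  rewrite Rmult_assoc, Rinv_l, Rmult_1_r by lra.
  apply Rabs_def1; nra.
Qed.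

Lemma nondecreasing_le_lim (f : R -> R) (l a : R) :
  (forall x y, a <= x -> x <= y -> f x <= f y) -> is_lim f p_infty l ->
  forall x, a <= x -> f x <= l.
Proof.
  intros Hm Hl x Hx.
  apply (is_lim_le_loc (fun _ => f x) f p_infty (f x) l); trivial.
  - exists x; intros; apply Hm; lra.
  - apply is_lim_const.
Qed.

(** Here the two nondecreasing differences tend to 0, so they are nonpositive; dividing by the
    negative [g] traps [f / g] between [L - eps/2] and [L + eps/2]. *)
Lemma lhopital_zero (f g g' r : R -> R) (L : R) :
  (forall x, is_derive f x (r x * g' x)) -> (forall x, is_derive g x (g' x)) ->
  (forall x, 0 <= g' x) -> (forall x, g x < 0) -> is_lim r p_infty L ->
  is_lim f p_infty 0 -> is_lim g p_infty 0 ->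
  is_lim (fun x => f x / g x) p_infty L.
Proof.
  intros Hf Hg Hg' Hneg Hr Hfl Hgl. apply is_lim_spec; intros [eps Heps]; simpl.
  assert (He : 0 < eps / 2) by lra.
  destruct (lhopital_sandwich f g g' r L _ Hf Hg Hg' Hr He) as [a Ha].
  assert (Hlim : forall k, is_lim (fun x => k * g x) p_infty 0).
  { intros k. replace (Finite 0) with (Rbar_mult k 0) by (simpl; f_equal; ring).
    now apply is_lim_scal_l. }
  assert (H1 : forall x, a <= x -> f x - (L - eps / 2) * g x <= 0).
  { apply nondecreasing_le_lim; [intros; now apply Ha|].
    replace (Finite 0) with (Finite (0 - 0)) by (f_equal; ring).
    apply is_lim_minus'; trivial. }
  assert (H2 : forall x, a <= x -> (L + eps / 2) * g x - f x <= 0).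
  { apply nondecreasing_le_lim; [intros; now apply Ha|].
    replace (Finite 0) with (Finite (0 - 0)) by (f_equal; ring).
    apply is_lim_minus'; trivial. }
  exists a; intros x Hx.
  specialize (H1 x (Rlt_le _ _ Hx)). specialize (H2 x (Rlt_le _ _ Hx)).
  specialize (Hneg x).
  replace (f x / g x - L) with ((L * g x - f x) / (- g x)) by (field; lra).
  unfold Rdiv; rewrite Rabs_mult, (Rabs_right (/ (- g x))).
  2: apply Rle_ge, Rlt_le, Rinv_0_lt_compat; lra.
  apply (Rmult_lt_reg_r (- g x)); [lra|].
  rewrite Rmult_assoc, Rinv_l, Rmult_1_r by lra.
  apply Rabs_def1; nra.
Qed.

Lemma nondecreasing_bounded_lim (f : R -> R) (a B : R) :
  (forall x y, a <= x -> x <= y -> f x <= f y) -> (forall x, a <= x -> f x <= B) ->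
  exists l : R, is_lim f p_infty l.
Proof.
  intros Hm HB.
  destruct (completeness (fun y => exists x, a <= x /\ y = f x)) as [l [Hub Hleast]].
  - exists B; intros y [x [Hx ->]]; now apply HB.
  - exists (f a), a; split; [apply Rle_refl|trivial].
  - exists l. apply is_lim_spec; intros [eps Heps]; simpl.
    assert (Hex : exists x, a <= x /\ l - eps < f x).
    { apply NNPP; intros Hno.
      assert (l <= l - eps); [|lra].
      apply Hleast; intros y [x [Hx ->]].
      apply Rnot_lt_le; intros Hlt; apply Hno; now exists x. }
    destruct Hex as [x [Hx Hlt]]. exists x; intros y Hy.
    assert (f x <= f y) by (apply Hm; lra).
    assert (f y <= l) by (apply Hub; exists y; split; [lra|trivial]).
    apply Rabs_def1; lra.
Qed.

(** * Limits of exponentials, products and inverses at infinity *)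

Lemma is_lim_exp_scal_0 (a : R) :
  a < 0 -> is_lim (fun t => exp (a * t)) p_infty 0.
Proof.
  intros Ha. apply (is_lim_comp exp (fun t => a * t) p_infty 0 m_infty).
  - apply is_lim_exp_m.
  - replace m_infty with (Rbar_mult a p_infty).
    + apply (is_lim_scal_l (fun t => t)), is_lim_id.
    + simpl. destruct (Rle_dec 0 a); [exfalso; lra|trivial].
  - now exists 0.
Qed.

Lemma is_lim_exp_scal_infinity (a : R) :
  0 < a -> is_lim (fun t => exp (a * t)) p_infty p_infty.
Proof.
  intros Ha. apply (is_lim_comp exp (fun t => a * t) p_infty p_infty p_infty).
  - apply is_lim_exp_p.
  - replace p_infty with (Rbar_mult a p_infty) at 2.
    + apply (is_lim_scal_l (fun t => t)), is_lim_id.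
    + simpl. destruct (Rle_dec 0 a); [|exfalso; lra].
      destruct (Rle_lt_or_eq_dec 0 a r); [trivial|lra].
  - now exists 0.
Qed.

Lemma is_lim_mult_infinity (f g : R -> R) (c : R) :
  0 < c -> is_lim f p_infty c -> is_lim g p_infty p_infty ->
  is_lim (fun t => f t * g t) p_infty p_infty.
Proof.
  intros Hc Hf Hg.
  replace p_infty with (Rbar_mult c p_infty) at 2.
  - apply is_lim_mult; trivial. simpl; lra.
  - simpl. destruct (Rle_dec 0 c); [|exfalso; lra].
    destruct (Rle_lt_or_eq_dec 0 c r); [trivial|lra].
Qed.

Lemma is_lim_mult_finite (f g : R -> R) (a b : R) :
  is_lim f p_infty a -> is_lim g p_infty b ->
  is_lim (fun t => f t * g t) p_infty (a * b).
Proof.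
  intros Hf Hg. apply (is_lim_mult f g p_infty a b); trivial. exact I.
Qed.

Lemma is_lim_inv_finite (f : R -> R) (a : R) :
  a <> 0 -> is_lim f p_infty a -> is_lim (fun t => / f t) p_infty (/ a).
Proof.
  intros Ha Hf. apply (is_lim_inv f p_infty a); trivial. intros H; injection H; trivial.
Qed.

Lemma is_lim_inv_0 (f : R -> R) :
  (forall t, 0 < f t) -> is_lim f p_infty 0 -> is_lim (fun t => / f t) p_infty p_infty.
Proof.
  intros Hpos Hf. apply is_lim_spec; intros M; simpl.
  (* [Rabs M + 1] is positive for every [M], so its inverse is an admissible tolerance. *)
  assert (HM : 0 < / (Rabs M + 1)).
  { apply Rinv_0_lt_compat. pose proof (Rabs_pos M); lra. }
  destruct (proj2 (is_lim_spec f p_infty 0) Hf (mkposreal _ HM)) as [T HT]; simpl in HT.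
  exists T; intros t Ht. specialize (HT t Ht). specialize (Hpos t).
  rewrite Rminus_0_r, Rabs_right in HT by lra.
  apply Rinv_lt_contravar in HT.
  - rewrite Rinv_inv in HT. pose proof (Rle_abs M). lra.
  - now apply Rmult_lt_0_compat.
Qed.

(** * Primitives of functions asymptotic to an exponential *)

(** This is [K t ~ c e^(lam t)] at +oo; behaviour at -oo is expressed by applying it to
    [fun t => K (- t)]. *)
Definition exp_asymptotic (K : R -> R) (lam c : R) : Prop :=
  0 < c /\ is_lim (fun t => K t * exp (- (lam * t))) p_infty c.

Lemma exp_neg_mul_exp (x : R) : exp (- x) * exp x = 1.
Proof. rewrite <- exp_plus, Rplus_opp_l; apply exp_0. Qed.

Lemma is_derive_exp_scal (a t : R) :
  a <> 0 -> is_derive (fun t => exp (a * t) / a) t (exp (a * t)).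
Proof. intros Ha. auto_derive; [trivial|]. field; trivial. Qed.

Lemma exp_asymptotic_lim_0 (K : R -> R) (lam c a : R) :
  exp_asymptotic K lam c -> lam < a ->
  is_lim (fun t => K t * exp (- (a * t))) p_infty 0.
Proof.
  intros [Hc HK] Ha.
  apply (is_lim_ext (fun t => (K t * exp (- (lam * t))) * exp ((lam - a) * t))).
  - intros t. rewrite Rmult_assoc, <- exp_plus. do 2 f_equal; ring.
  - replace 0 with (c * 0) by ring.
    apply is_lim_mult_finite; trivial. apply is_lim_exp_scal_0; lra.
Qed.

Lemma exp_asymptotic_lim_infinity (K : R -> R) (lam c a : R) :
  exp_asymptotic K lam c -> a < lam ->
  is_lim (fun t => K t * exp (- (a * t))) p_infty p_infty.
Proof.
  intros [Hc HK] Ha.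
  apply (is_lim_ext (fun t => (K t * exp (- (lam * t))) * exp ((lam - a) * t))).
  - intros t. rewrite Rmult_assoc, <- exp_plus. do 2 f_equal; ring.
  - apply (is_lim_mult_infinity _ _ c); trivial. apply is_lim_exp_scal_infinity; lra.
Qed.

(** The tolerance [c / 2] gives explicit bounds: the upper one makes primitives converge when
    [lam < 0], the lower one makes them diverge when [lam >= 0]. *)
Lemma exp_asymptotic_bounds (K : R -> R) (lam c : R) :
  exp_asymptotic K lam c ->
  exists M, forall t, M <= t ->
    c / 2 * exp (lam * t) <= K t /\ K t <= 2 * c * exp (lam * t).
Proof.
  intros [Hc HK].
  assert (Hc2 : 0 < c / 2) by lra.
  destruct (proj2 (is_lim_spec _ p_infty c) HK (mkposreal _ Hc2)) as [M HM]; simpl in HM.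
  exists (M + 1); intros t Ht. specialize (HM t ltac:(lra)). apply Rabs_def2 in HM.
  pose proof (exp_pos (lam * t)). pose proof (exp_neg_mul_exp (lam * t)).
  replace (K t) with (K t * exp (- (lam * t)) * exp (lam * t))
    by (rewrite Rmult_assoc, H0; ring).
  split; apply Rmult_le_compat_r; lra.
Qed.

Lemma primitive_increasing (K A : R -> R) :
  (forall t, 0 < K t) -> (forall t, is_derive A t (K t)) ->
  forall x y, x < y -> A x < A y.
Proof.
  intros HK HA x y Hxy.
  destruct (MVT_gen A x y K) as [c [Hc Heq]].
  - intros; apply HA.
  - intros z _; apply continuity_pt_filterlim, (ex_derive_continuous A).
    now exists (K z).
  - specialize (HK c). nra.
Qed.

(** Eventually [K t <= 2 c e^(lam t)], so [A] grows no faster than [2 c e^(lam t) / lam], which is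
    negative for [lam < 0]. The strict bound on [A] later makes the horizon integrals positive. *)
Lemma primitive_converges (K A : R -> R) (lam c : R) :
  (forall t, 0 < K t) -> (forall t, is_derive A t (K t)) ->
  exp_asymptotic K lam c -> lam < 0 ->
  exists l : R, is_lim A p_infty l /\ forall t, A t < l.
Proof.
  intros HK HA Has Hlam.
  pose proof (primitive_increasing K A HK HA) as Hinc.
  destruct (exp_asymptotic_bounds K lam c Has) as [M HM].
  destruct Has as [Hc _].
  (* This bound is what the comparison on [[M, oo)] yields once the negative term at [x] is
     dropped. *)
  destruct (nondecreasing_bounded_lim A M (A M - 2 * c * (exp (lam * M) / lam)))
    as [l Hl].
  - intros x y _ [Hxy| ->]; [now apply Rlt_le, Hinc|apply Rle_refl].
  - intros x Hx.
    assert (2 * c * (exp (lam * M) / lam) - A M <= 2 * c * (exp (lam * x) / lam) - A x).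
    { apply (nondecreasing_of_derive_nonneg (fun t => 2 * c * (exp (lam * t) / lam) - A t)
               (fun t => 2 * c * exp (lam * t) - K t) M); trivial; try lra.
      - intros t. apply (is_derive_minus (fun t => 2 * c * (exp (lam * t) / lam)) A);
          [|apply HA].
        apply (is_derive_scal (fun t => exp (lam * t) / lam)), is_derive_exp_scal; lra.
      - intros t Ht. specialize (HM t Ht). lra. }
    assert (exp (lam * x) / lam < 0); [|nra].
    unfold Rdiv; pose proof (exp_pos (lam * x)). pose proof (Rinv_lt_0_compat lam Hlam). nra.
  - exists l; split; trivial. intros t.
    (* Strictness comes from a later point: [A t < A (t + 1) <= l]. *)
    apply Rlt_le_trans with (A (t + 1)); [apply Hinc; lra|].
    apply (nondecreasing_le_lim A l t); trivial; try lra.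
    intros x y _ [Hxy| ->]; [now apply Rlt_le, Hinc|apply Rle_refl].
Qed.

Lemma exp_asymptotic_lim_0_of_neg (K : R -> R) (lam c : R) :
  exp_asymptotic K lam c -> lam < 0 -> is_lim K p_infty 0.
Proof.
  intros Has Hlam.
  apply (is_lim_ext (fun t => K t * exp (- (0 * t)))).
  - intros t. rewrite Rmult_0_l, Ropp_0, exp_0; ring.
  - now apply (exp_asymptotic_lim_0 K lam c).
Qed.

(** Trades the comparison function [e^(lam t) / lam] for [K] itself: their quotient tends to
    [1 / (lam c)], and the factor [c] cancels. *)
Lemma is_lim_div_of_exp_ratio (K f : R -> R) (lam c : R) :
  (forall t, 0 < K t) -> lam <> 0 -> exp_asymptotic K lam c ->
  is_lim (fun t => f t / (exp (lam * t) / lam)) p_infty c ->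
  is_lim (fun t => f t / K t) p_infty (/ lam).
Proof.
  intros Kpos Hlam [Hc HK] Hf.
  apply (is_lim_ext
    (fun t => (f t / (exp (lam * t) / lam)) * / (lam * (K t * exp (- (lam * t)))))).
  - intros t. rewrite exp_Ropp. pose proof (exp_pos (lam * t)). specialize (Kpos t).
    field. repeat split; lra.
  - replace (/ lam) with (c * / (lam * c)) by (field; lra).
    apply is_lim_mult_finite; trivial.
    apply is_lim_inv_finite; [apply Rmult_integral_contrapositive; lra|].
    now apply (is_lim_scal_l _ lam p_infty c).
Qed.

Lemma mul_exp_neg_mul_exp (k x : R) : k * exp (- x) * exp x = k.
Proof. rewrite Rmult_assoc, exp_neg_mul_exp; ring. Qed.

(** [A - l] and [e^(lam t) / lam] both vanish at infinity, the latter through negative values, and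
    their derivatives have ratio [K e^(-lam t)], so the zero form of l'Hopital's rule applies. *)
Lemma primitive_minus_lim_ratio (K A : R -> R) (lam c l : R) :
  (forall t, 0 < K t) -> (forall t, is_derive A t (K t)) ->
  exp_asymptotic K lam c -> lam < 0 -> is_lim A p_infty l ->
  is_lim (fun t => (A t - l) / K t) p_infty (/ lam).
Proof.
  intros HK HA Has Hlam Hl.
  apply (is_lim_div_of_exp_ratio K _ lam c); trivial; try lra.
  apply (lhopital_zero (fun t => A t - l) (fun t => exp (lam * t) / lam)
           (fun t => exp (lam * t)) (fun t => K t * exp (- (lam * t)))).
  - intros t. rewrite mul_exp_neg_mul_exp.
    replace (K t) with (K t - 0) by ring.
    apply (is_derive_minus A (fun _ => l)); [apply HA|apply @is_derive_const].
  - intros t; apply is_derive_exp_scal; lra.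
  - intros t; apply Rlt_le, exp_pos.
  - intros t. unfold Rdiv; pose proof (exp_pos (lam * t)).
    pose proof (Rinv_lt_0_compat lam Hlam). nra.
  - apply Has.
  - replace 0 with (l - l) by ring. apply is_lim_minus'; trivial. apply is_lim_const.
  - replace 0 with (0 * / lam) by ring.
    apply is_lim_mult_finite; [now apply is_lim_exp_scal_0|apply is_lim_const].
Qed.

(** For [lam > 0] the comparison function tends to infinity, so the infinite form of the rule
    applies and the additive constant in [A] does not affect the limit. *)
Lemma primitive_ratio (K A : R -> R) (lam c : R) :
  (forall t, 0 < K t) -> (forall t, is_derive A t (K t)) ->
  exp_asymptotic K lam c -> 0 < lam ->
  is_lim (fun t => A t / K t) p_infty (/ lam).
Proof.
  intros HK HA Has Hlam.
  apply (is_lim_div_of_exp_ratio K _ lam c); trivial; try lra.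
  apply (lhopital_infinity A (fun t => exp (lam * t) / lam)
           (fun t => exp (lam * t)) (fun t => K t * exp (- (lam * t)))).
  - intros t. rewrite mul_exp_neg_mul_exp. apply HA.
  - intros t; apply is_derive_exp_scal; lra.
  - intros t; apply Rlt_le, exp_pos.
  - apply Has.
  - apply (is_lim_ext (fun t => / lam * exp (lam * t))); [intros; unfold Rdiv; ring|].
    apply (is_lim_mult_infinity _ _ (/ lam)).
    + now apply Rinv_0_lt_compat.
    + apply is_lim_const.
    + now apply is_lim_exp_scal_infinity.
Qed.

(** Eventually [K >= (c / 2) e^(lam t) >= c / 2], so [A] lies above a line of slope [c / 2]. *)
Lemma primitive_diverges (K A : R -> R) (lam c : R) :
  (forall t, is_derive A t (K t)) ->
  exp_asymptotic K lam c -> 0 <= lam -> is_lim A p_infty p_infty.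
Proof.
  intros HA Has Hlam.
  destruct (exp_asymptotic_bounds K lam c Has) as [M HM].
  destruct Has as [Hc _].
  (* Nonnegativity of [a] is what gives [e^(lam t) >= 1] on [[a, oo)]. *)
  set (a := Rmax M 0).
  assert (Ha : M <= a /\ 0 <= a) by (split; [apply Rmax_l|apply Rmax_r]).
  apply (is_lim_le_p_loc (fun t => c / 2 * (t - a) + A a)).
  - exists a; intros x Hx.
    enough (A a - c / 2 * a <= A x - c / 2 * x) by lra.
    apply (nondecreasing_of_derive_nonneg (fun t => A t - c / 2 * t)
             (fun t => K t - c / 2) a); try lra.
    + intros t. apply (is_derive_minus A (fun t => c / 2 * t)); [apply HA|].
      auto_derive; [trivial|ring].
    + intros t Ht. destruct (HM t ltac:(lra)) as [H1 _].
      assert (1 <= exp (lam * t)).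
      { rewrite <- exp_0. destruct (Rle_lt_or_eq_dec 0 (lam * t)) as [H2|H2].
        - apply Rmult_le_pos; lra.
        - now apply Rlt_le, exp_increasing.
        - rewrite <- H2; apply Rle_refl. }
      nra.
  - apply is_lim_spec; intros B; simpl.
    (* The abscissa at which the comparison line reaches [B]. *)
    exists ((B - A a) * (2 / c) + a); intros x Hx.
    assert (H1 : (B - A a) * (2 / c) < x - a) by lra.
    apply (Rmult_lt_compat_r (c / 2)) in H1; [|lra].
    replace ((B - A a) * (2 / c) * (c / 2)) with (B - A a) in H1 by (field; lra). lra.
Qed.

(** For [lam < 0], [K] tends to 0 while [A] stays above [b]; for [lam = 0], [K] tends to [c] while
    [A] diverges. *)
Lemma primitive_ratio_infinity (K A : R -> R) (lam c b : R) :
  (forall t, 0 < K t) -> (forall t, is_derive A t (K t)) ->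
  exp_asymptotic K lam c -> lam <= 0 -> 0 < b -> (forall t, 0 <= t -> b <= A t) ->
  is_lim (fun t => A t / K t) p_infty p_infty.
Proof.
  intros HK HA Has [Hlam|Hlam] Hb HbA.
  - apply (is_lim_le_p_loc (fun t => b * / K t)).
    + exists 0; intros t Ht. apply Rmult_le_compat_r; [|apply HbA; lra].
      apply Rlt_le, Rinv_0_lt_compat, HK.
    + apply (is_lim_mult_infinity _ _ b); trivial; [apply is_lim_const|].
      apply is_lim_inv_0; trivial. now apply (exp_asymptotic_lim_0_of_neg K lam c).
  - assert (HAinf : is_lim A p_infty p_infty)
      by (apply (primitive_diverges K A lam c); trivial; lra).
    destruct Has as [Hc HKc].
    apply (is_lim_ext (fun t => / K t * A t)); [intros; unfold Rdiv; ring|].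
    apply (is_lim_mult_infinity _ _ (/ c)); trivial; [now apply Rinv_0_lt_compat|].
    apply is_lim_inv_finite; [lra|].
    refine (is_lim_ext _ _ _ _ _ HKc).
    intros t. rewrite Hlam, Rmult_0_l, Ropp_0, exp_0. apply Rmult_1_r.
Qed.

(** L'Hopital's rule against [e^t]. Since the event horizon is a primitive of [K] times [e^(-t)],
    this settles its limit at the origin for [N >= 0]. *)
Lemma primitive_div_exp (K A : R -> R) (L : R) :
  (forall t, is_derive A t (K t)) -> is_lim (fun t => K t * exp (- t)) p_infty L ->
  is_lim (fun t => A t / exp t) p_infty L.
Proof.
  intros HA HL.
  apply (lhopital_infinity A exp exp (fun t => K t * exp (- t))); trivial.
  - intros t. rewrite Rmult_assoc, exp_neg_mul_exp, Rmult_1_r. apply HA.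
  - apply is_derive_exp.
  - intros t; apply Rlt_le, exp_pos.
  - apply is_lim_exp_p.
Qed.

(** * The substitution [t = ln (1 + z)] in limits, integrals and derivatives *)

Lemma filterlim_ln_origin :
  filterlim (fun z => ln (1 + z)) (Rbar_locally p_infty) (Rbar_locally p_infty).
Proof.
  apply (filterlim_comp _ _ _ (fun z => 1 + z) ln _ (Rbar_locally p_infty)).
  - intros P [M HM]. exists (M - 1); intros z Hz; apply HM; lra.
  - apply is_lim_ln_p.
Qed.

Lemma filterlim_ln_future :
  filterlim (fun z => - ln (1 + z)) (at_right (-1)) (Rbar_locally p_infty).
Proof.
  apply (filterlim_comp _ _ _ (fun z => ln (1 + z)) Ropp _ (Rbar_locally m_infty)).
  - apply (filterlim_comp _ _ _ (fun z => 1 + z) ln _ (at_right 0)); [|apply is_lim_ln_0].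
    intros P [eps HP]. exists eps; intros z Hz Hlt; apply HP; [|lra].
    revert Hz. unfold ball; simpl; unfold AbsRing_ball, abs, minus, plus, opp; simpl.
    now replace (1 + z + - 0) with (z + - -1) by ring.
  - apply (filterlim_Rbar_opp m_infty).
Qed.

Lemma at_right_gt (a : R) : at_right a (fun z => a < z).
Proof. exists (mkposreal 1 Rlt_0_1); trivial. Qed.

Lemma lim_origin_of_log (f g : R -> R) (l : Rbar) :
  (forall z, -1 < z -> f z = g (ln (1 + z))) -> is_lim g p_infty l -> lim_origin f l.
Proof.
  intros Hfg Hg.
  apply (filterlim_ext_loc (fun z => g (ln (1 + z)))).
  - exists (-1); intros z Hz; symmetry; now apply Hfg.
  - exact (filterlim_comp _ _ _ _ g _ _ _ filterlim_ln_origin Hg).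
Qed.

(** The far future is [t -> -oo]; reflecting [t] lets the growth lemmas, all stated at +oo, apply
    there. *)
Lemma lim_future_of_log (f g : R -> R) (l : Rbar) :
  (forall z, -1 < z -> f z = g (ln (1 + z))) ->
  is_lim (fun t => g (- t)) p_infty l -> lim_future f l.
Proof.
  intros Hfg Hg.
  apply (filterlim_ext_loc (fun z => g (- - ln (1 + z)))).
  - refine (filter_imp _ _ _ (at_right_gt (-1))).
    intros z Hz. rewrite Ropp_involutive. symmetry; now apply Hfg.
  - exact (filterlim_comp _ _ _ _ (fun t => g (- t)) _ _ _ filterlim_ln_future Hg).
Qed.

(** The fundamental theorem with filters as endpoints, so that one statement covers the endpoint +oo
    of the particle horizon and the endpoint -1 of the event horizon. *)
Lemma is_RInt_gen_primitive (Fa Fb : (R -> Prop) -> Prop) {FFa : Filter Fa} {FFb : Filter Fb}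
  (f Phi : R -> R) (la lb : R) :
  Fa (fun z => -1 < z) -> Fb (fun z => -1 < z) ->
  (forall z, -1 < z -> is_derive Phi z (f z)) -> (forall z, -1 < z -> continuous f z) ->
  filterlim Phi Fa (locally la) -> filterlim Phi Fb (locally lb) ->
  is_RInt_gen f Fa Fb (lb - la).
Proof.
  intros Ha Hb Hd Hc Hla Hlb.
  assert (Hdom : forall a b x, -1 < a -> -1 < b -> Rmin a b <= x -> -1 < x).
  { intros a b x H1 H2 H3. pose proof (Rmin_glb_lt a b (-1) H1 H2). lra. }
  (* [is_RInt_gen_Derive] integrates [Derive Phi], which is known to equal [f] only on [(-1, oo)];
     eventually the whole segment between the endpoints lies there. *)
  apply (is_RInt_gen_ext (Derive Phi)).
  - exists (fun z => -1 < z) (fun z => -1 < z); trivial.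
    intros a b H1 H2 x [Hx _]; simpl in Hx.
    apply is_derive_unique, Hd, (Hdom a b); lra.
  - apply is_RInt_gen_Derive; trivial;
      exists (fun z => -1 < z) (fun z => -1 < z); trivial;
      intros a b H1 H2 x [Hx _]; simpl in Hx;
      assert (Hx1 : -1 < x) by (apply (Hdom a b); lra).
    + exists (f x). now apply Hd.
    + apply (continuous_ext_loc _ f); [|now apply Hc].
      refine (filter_imp _ _ _ (open_gt (-1) x Hx1)).
      intros y Hy; symmetry; now apply is_derive_unique, Hd.
Qed.

Lemma is_derive_comp_log (B dB : R -> R) (z : R) :
  (forall t, is_derive B t (dB t)) -> -1 < z ->
  is_derive (fun z => B (ln (1 + z))) z (dB (ln (1 + z)) / (1 + z)).
Proof.
  intros HB Hz.
  replace (dB (ln (1 + z)) / (1 + z)) with (/ (1 + z) * dB (ln (1 + z)))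
    by (unfold Rdiv; ring).
  apply (is_derive_comp B (fun z => ln (1 + z))); [apply HB|].
  auto_derive; [lra|]. field; lra.
Qed.

(* In the variable t = ln (1 + z) the measure dz / H becomes K t dt. *)
Definition log_density (H K : R -> R) : Prop :=
  (forall t, 0 < K t) /\ (forall t, continuous K t) /\
  (forall z, -1 < z -> H z = (1 + z) / K (ln (1 + z))).

Lemma inv_hubble_log (H K : R -> R) (z : R) :
  log_density H K -> -1 < z -> / H z = K (ln (1 + z)) / (1 + z).
Proof.
  intros (HK & _ & HH) Hz. rewrite HH by trivial. specialize (HK (ln (1 + z))).
  field; lra.
Qed.

Lemma continuous_inv_hubble (H K : R -> R) (z : R) :
  log_density H K -> -1 < z -> continuous (fun x => / H x) z.
Proof.
  intros HHK Hz.
  apply (continuous_ext_loc _ (fun x => K (ln (1 + x)) * / (1 + x))).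
  - refine (filter_imp _ _ _ (open_gt (-1) z Hz)).
    intros y Hy; symmetry; now apply inv_hubble_log.
  - apply (continuous_mult (fun x => K (ln (1 + x))) (fun x => / (1 + x))).
    + apply (continuous_comp (fun x => ln (1 + x)) K); [|apply HHK].
      apply (ex_derive_continuous (fun x => ln (1 + x))). auto_derive; lra.
    + apply (ex_derive_continuous (fun x => / (1 + x))). auto_derive; lra.
Qed.

Lemma continuous_primitive (K : R -> R) :
  (forall t, continuous K t) -> exists A, forall t, is_derive A t (K t).
Proof.
  intros HK. exists (fun t => RInt K 0 t). intros t.
  apply (is_derive_RInt K (fun t => RInt K 0 t) 0 t); [|apply HK].
  apply filter_forall; intros b. apply (@RInt_correct R_CompleteNormedModule).
  apply (@ex_RInt_continuous R_CompleteNormedModule); intros; apply HK.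
Qed.

(** Transfers results at +oo to -oo; the outer sign compensates the inner derivative. *)
Lemma is_derive_reflect (A K : R -> R) (t : R) :
  (forall t, is_derive A t (K t)) -> is_derive (fun t => - A (- t)) t (K (- t)).
Proof.
  intros HA. replace (K (- t)) with (- (- 1 * K (- t))) by ring.
  apply (is_derive_opp (fun t => A (- t))).
  apply (is_derive_comp A Ropp); [apply HA|].
  auto_derive; [trivial|ring].
Qed.

(** With [s = -1] for the particle and [s = 1] for the event horizon, [X' = (s K - B) / (1 + z)^2],
    and multiplying by [-(1 + z) H = -(1 + z)^2 / K] leaves [B / K - s]. Differentiability is
    recorded because [Derive] is total. *)
Lemma horizon_time_derivative (H K X B : R -> R) (s z : R) :
  log_density H K -> (forall t, is_derive B t (s * K t)) ->
  (forall z, -1 < z -> X z = / (1 + z) * B (ln (1 + z))) -> -1 < z ->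
  ex_derive X z /\
  time_derivative H X z = B (ln (1 + z)) / K (ln (1 + z)) - s.
Proof.
  intros HHK HB HX Hz.
  set (t := ln (1 + z)).
  assert (Hd : is_derive X z (- / (1 + z) ^ 2 * B t + / (1 + z) * (s * K t / (1 + z)))).
  { apply (is_derive_ext_loc (fun z => / (1 + z) * B (ln (1 + z)))).
    - refine (filter_imp _ _ _ (open_gt (-1) z Hz)).
      intros y Hy; symmetry; now apply HX.
    - apply (is_derive_mult (fun z => / (1 + z)) (fun z => B (ln (1 + z)))).
      + auto_derive; [lra|]. field; lra.
      + now apply (is_derive_comp_log B (fun t => s * K t)).
      + intros; apply Rmult_comm. }
  split; [eexists; exact Hd|].
  unfold time_derivative. rewrite (is_derive_unique _ _ _ Hd).
  destruct HHK as (HK & _ & HH). rewrite HH by trivial. fold t.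
  specialize (HK t). field; lra.
Qed.

Lemma exp_log_shift (z : R) : -1 < z -> exp (ln (1 + z)) = 1 + z.
Proof. intros Hz. apply exp_ln; lra. Qed.

Lemma is_lim_minus_const (f : R -> R) (l c : R) :
  is_lim f p_infty l -> is_lim (fun t => f t - c) p_infty (l - c).
Proof. intros Hf. apply is_lim_minus'; trivial. apply is_lim_const. Qed.

Lemma is_lim_minus_const_infinity (f : R -> R) (c : R) :
  is_lim f p_infty p_infty -> is_lim (fun t => f t - c) p_infty p_infty.
Proof.
  intros Hf. apply is_lim_spec; intros M; simpl.
  destruct (proj2 (is_lim_spec f p_infty p_infty) Hf (M + c)) as [T HT].
  exists T; intros t Ht. specialize (HT t Ht). lra.
Qed.

(** * Limits of the two horizons and of their time derivatives *)

Lemma particle_horizon_limits (H K : R -> R) (N m c c' : R) :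
  log_density H K -> exp_asymptotic K (1 - N / 2) c ->
  exp_asymptotic (fun t => K (- t)) (m / 2 - 1) c' -> 2 < N ->
  (forall z, -1 < z -> particle_horizon_finite H z /\ ex_derive (particle_horizon H) z) /\
  lim_origin (particle_horizon H) 0 /\
  lim_future (particle_horizon H) p_infty /\
  lim_origin (time_derivative H (particle_horizon H)) (N / (N - 2)) /\
  (m <= 2 -> lim_future (time_derivative H (particle_horizon H)) p_infty) /\
  (2 < m -> lim_future (time_derivative H (particle_horizon H)) (m / (m - 2))).
Proof.
  intros HHK Has Has' HN.
  assert (HK := proj1 HHK).
  assert (HK' : forall t, 0 < K (- t)) by (intros; apply HK).
  destruct (continuous_primitive K (proj1 (proj2 HHK))) as [A HA].
  (* [N > 2] makes the rate [1 - N / 2] negative, so the tail integral [l - A] exists. *)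
  destruct (primitive_converges K A _ c HK HA Has ltac:(lra)) as [l [Hl HlA]].
  set (B := fun t => l - A t).
  assert (HBd : forall t, is_derive B t (- 1 * K t)).
  { intros t. replace (- 1 * K t) with (0 - K t) by ring.
    apply (is_derive_minus (fun _ => l) A); [apply @is_derive_const|apply HA]. }
  assert (HB'd : forall t, is_derive (fun t => B (- t)) t (K (- t))).
  { intros t. apply (is_derive_ext (fun t => - A (- t) + l)); [intros; unfold B; simpl; ring|].
    replace (K (- t)) with (K (- t) + 0) by ring.
    apply (is_derive_plus (fun t => - A (- t)) (fun _ => l)); [|apply @is_derive_const].
    now apply is_derive_reflect. }
  assert (Hint : forall z, -1 < z ->
    is_RInt_gen (fun x => / H x) (at_point z) (Rbar_locally p_infty) (B (ln (1 + z)))).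
  { intros z Hz.
    (* The boundary values are [A (ln (1 + z))] and [l]; their difference is [B (ln (1 + z))] by
       conversion. *)
    apply (is_RInt_gen_primitive _ _ _ (fun z => A (ln (1 + z)))).
    - exact Hz.
    - now exists (-1).
    - intros y Hy. rewrite (inv_hubble_log H K) by trivial. now apply is_derive_comp_log.
    - intros y Hy. now apply (continuous_inv_hubble H K).
    - intros P HP. apply (locally_singleton _ _ HP).
    - exact (filterlim_comp _ _ _ _ A _ _ _ filterlim_ln_origin Hl). }
  assert (HX : forall z, -1 < z -> particle_horizon H z = / (1 + z) * B (ln (1 + z))).
  { intros z Hz. unfold particle_horizon. f_equal.
    apply (@is_RInt_gen_unique R_CompleteNormedModule); [apply _|apply _|now apply Hint]. }
  assert (HXe : forall z, -1 < z ->
    particle_horizon H z = (fun t => B t * exp (- t)) (ln (1 + z))).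
  { intros z Hz. rewrite HX, exp_Ropp, exp_log_shift by trivial. ring. }
  assert (HT : forall z, -1 < z -> time_derivative H (particle_horizon H) z =
    (fun t => B t / K t - - 1) (ln (1 + z))).
  { intros z Hz. now apply horizon_time_derivative. }
  assert (HBK : is_lim (fun t => B t / K t) p_infty (2 / (N - 2))).
  { apply (is_lim_ext (fun t => - 1 * ((A t - l) / K t))).
    - intros t; unfold B, Rdiv; ring.
    - replace (2 / (N - 2)) with (- 1 * / (1 - N / 2)) by (field; lra).
      apply (is_lim_scal_l _ (- 1) p_infty (/ (1 - N / 2))).
      apply (primitive_minus_lim_ratio K A _ c); trivial; lra. }
  (* [B] decreases, so in the far future it stays above the positive value [B 0]. *)
  assert (HB0 : forall t, 0 <= t -> B 0 <= B (- t)).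
  { intros t [Ht| <-]; [|rewrite Ropp_0; apply Rle_refl].
    unfold B. pose proof (primitive_increasing K A HK HA (- t) 0 ltac:(lra)). lra. }
  assert (HBpos : 0 < B 0) by (unfold B; specialize (HlA 0); lra).
  split; [|split; [|split; [|split; [|split]]]].
  - intros z Hz; split.
    + exists (B (ln (1 + z))); now apply Hint.
    + now apply (horizon_time_derivative H K (particle_horizon H) B (- 1)).
  - apply (lim_origin_of_log _ _ _ HXe).
    (* [B / K] has a finite limit, and [K e^(-t)] vanishes because [1 - N / 2 < 1]. *)
    apply (is_lim_ext (fun t => B t / K t * (K t * exp (- (1 * t))))).
    + intros t. rewrite Rmult_1_l. specialize (HK t). field; lra.
    + replace 0 with (2 / (N - 2) * 0) by ring.
      apply is_lim_mult_finite; trivial.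
      apply (exp_asymptotic_lim_0 K (1 - N / 2) c); trivial; lra.
  - apply (lim_future_of_log _ _ _ HXe).
    apply (is_lim_le_p_loc (fun t => B 0 * exp (1 * t))).
    + exists 0; intros t Ht. rewrite Ropp_involutive, Rmult_1_l.
      apply Rmult_le_compat_r; [apply Rlt_le, exp_pos|apply HB0; lra].
    + apply (is_lim_mult_infinity _ _ (B 0)); trivial; [apply is_lim_const|].
      apply is_lim_exp_scal_infinity; lra.
  - apply (lim_origin_of_log _ _ _ HT).
    replace (N / (N - 2)) with (2 / (N - 2) - - 1) by (field; lra).
    now apply is_lim_minus_const.
  - intros Hm. apply (lim_future_of_log _ _ _ HT), is_lim_minus_const_infinity.
    apply (primitive_ratio_infinity (fun t => K (- t)) (fun t => B (- t))
             (m / 2 - 1) c' (B 0)); trivial; lra.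
  - intros Hm. apply (lim_future_of_log _ _ _ HT).
    replace (m / (m - 2)) with (/ (m / 2 - 1) - - 1) by (field; lra).
    apply is_lim_minus_const.
    (* [B (- t)] is a primitive of [K (- t)], whose rate [m / 2 - 1] is now positive. *)
    apply (primitive_ratio (fun t => K (- t)) (fun t => B (- t)) _ c'); trivial; lra.
Qed.

(** Mirror image of the particle case: [K (- t)] has negative rate [m / 2 - 1], so the primitive
    converges at -oo and [B] integrates [K] from -oo to [t]. *)
Lemma event_horizon_limits (H K : R -> R) (N m c c' : R) :
  log_density H K -> exp_asymptotic K (1 - N / 2) c ->
  exp_asymptotic (fun t => K (- t)) (m / 2 - 1) c' -> m < 2 ->
  (forall z, -1 < z -> event_horizon_finite H z /\ ex_derive (event_horizon H) z) /\
  (0 < N -> lim_origin (event_horizon H) 0) /\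
  (N = 0 -> lim_origin (event_horizon H) c) /\
  (N < 0 -> lim_origin (event_horizon H) p_infty) /\
  (m < 0 -> lim_future (event_horizon H) 0) /\
  (m = 0 -> lim_future (event_horizon H) c') /\
  (0 < m -> lim_future (event_horizon H) p_infty) /\
  (2 <= N -> lim_origin (time_derivative H (event_horizon H)) p_infty) /\
  (N < 2 -> lim_origin (time_derivative H (event_horizon H)) (N / (2 - N))) /\
  lim_future (time_derivative H (event_horizon H)) (m / (2 - m)).
Proof.
  intros HHK Has Has' Hm.
  assert (HK := proj1 HHK).
  assert (HK' : forall t, 0 < K (- t)) by (intros; apply HK).
  destruct (continuous_primitive K (proj1 (proj2 HHK))) as [A HA].
  assert (HA' : forall t, is_derive (fun t => - A (- t)) t (K (- t)))
    by (intros; now apply is_derive_reflect).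
  destruct (primitive_converges _ _ _ c' HK' HA' Has' ltac:(lra)) as [l [Hl HlA]].
  (* Here [l] is the limit of [- A (- t)], that is minus the limit of [A] at -oo; hence the plus
     sign. *)
  set (B := fun t => A t + l).
  assert (HBd : forall t, is_derive B t (K t)).
  { intros t. replace (K t) with (K t + 0) by ring.
    apply (is_derive_plus A (fun _ => l)); [apply HA|apply @is_derive_const]. }
  assert (HBd1 : forall t, is_derive B t (1 * K t))
    by (intros; rewrite Rmult_1_l; apply HBd).
  assert (Hint : forall z, -1 < z ->
    is_RInt_gen (fun x => / H x) (at_right (-1)) (at_point z) (B (ln (1 + z)))).
  { intros z Hz. unfold B. replace (A (ln (1 + z)) + l) with (A (ln (1 + z)) - - l) by ring.
    apply (is_RInt_gen_primitive _ _ _ (fun z => A (ln (1 + z)))).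
    - apply at_right_gt.
    - exact Hz.
    - intros y Hy. rewrite (inv_hubble_log H K) by trivial. now apply is_derive_comp_log.
    - intros y Hy. now apply (continuous_inv_hubble H K).
    - apply (lim_future_of_log _ A (- l)); trivial.
      apply (is_lim_ext (fun t => - - A (- t))); [intros; ring|].
      now apply (is_lim_opp _ p_infty l).
    - intros P HP. apply (locally_singleton _ _ HP). }
  assert (HX : forall z, -1 < z -> event_horizon H z = / (1 + z) * B (ln (1 + z))).
  { intros z Hz. unfold event_horizon. f_equal.
    apply (@is_RInt_gen_unique R_CompleteNormedModule); [apply _|apply _|now apply Hint]. }
  assert (HXe : forall z, -1 < z ->
    event_horizon H z = (fun t => B t * exp (- t)) (ln (1 + z))).
  { intros z Hz. rewrite HX, exp_Ropp, exp_log_shift by trivial. ring. }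
  assert (HT : forall z, -1 < z -> time_derivative H (event_horizon H) z =
    (fun t => B t / K t - 1) (ln (1 + z))).
  { intros z Hz. now apply horizon_time_derivative. }
  assert (HB0 : forall t, 0 <= t -> B 0 <= B t).
  { intros t [Ht| <-]; [|apply Rle_refl].
    unfold B. pose proof (primitive_increasing K A HK HA 0 t Ht). lra. }
  assert (HBpos : 0 < B 0) by (unfold B; specialize (HlA 0); rewrite Ropp_0 in HlA; lra).
  assert (HBK' : is_lim (fun t => B (- t) / K (- t)) p_infty (2 / (2 - m))).
  (* [- A (- t) - l] is [- B (- t)], which accounts for the factor [- 1]. *)
  { apply (is_lim_ext (fun t => - 1 * ((- A (- t) - l) / K (- t)))).
    - intros t; unfold B, Rdiv; ring.
    - replace (2 / (2 - m)) with (- 1 * / (m / 2 - 1)) by (field; lra).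
      apply (is_lim_scal_l _ (- 1) p_infty (/ (m / 2 - 1))).
      apply (primitive_minus_lim_ratio (fun t => K (- t)) (fun t => - A (- t)) _ c');
        trivial; lra. }
  assert (HBK : N < 2 -> is_lim (fun t => B t / K t) p_infty (/ (1 - N / 2))).
  { intros HN. apply (primitive_ratio K B _ c); trivial; lra. }
  (* Covers [N > 0] and [N = 0], where [K e^(-t)] has the finite limits 0 and [c]. *)
  assert (HBexp : forall L : R, is_lim (fun t => K t * exp (- (1 * t))) p_infty L ->
    lim_origin (event_horizon H) L).
  { intros L HL. apply (lim_origin_of_log _ _ _ HXe).
    apply (is_lim_ext (fun t => B t / exp t)).
    - intros t; unfold Rdiv; now rewrite exp_Ropp.
    - apply (primitive_div_exp K); trivial.
      apply (is_lim_ext (fun t => K t * exp (- (1 * t)))); trivial.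
      intros t; now rewrite Rmult_1_l. }
  (* Factors the reflected horizon through [B / K], whose limit [2 / (2 - m)] is positive; comparing
     the rate [m / 2 - 1] with [-1] then leaves the sign of [m] to decide. *)
  assert (Hfut : forall t, B (- t) / K (- t) * (K (- t) * exp (- (- 1 * t)))
    = B (- t) * exp (- - t)).
  { intros t. specialize (HK' t). replace (- (- 1 * t)) with (- - t) by ring.
    field; lra. }
  assert (Hpos : 0 < 2 / (2 - m)) by (apply Rdiv_lt_0_compat; lra).
  split; [|split; [|split; [|split; [|split; [|split; [|split; [|split; [|split]]]]]]]].
  - intros z Hz; split.
    + exists (B (ln (1 + z))); now apply Hint.
    + now apply (horizon_time_derivative H K (event_horizon H) B 1).
  - intros HN. apply HBexp, (exp_asymptotic_lim_0 K (1 - N / 2) c); trivial; lra.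
  - intros HN. apply HBexp. replace 1 with (1 - N / 2) by (rewrite HN; field). apply Has.
  - intros HN. apply (lim_origin_of_log _ _ _ HXe).
    (* For [N < 0], [B / K] has a positive limit and [K e^(-t)] grows at rate [- N / 2]. *)
    apply (is_lim_ext (fun t => B t / K t * (K t * exp (- (1 * t))))).
    + intros t. rewrite Rmult_1_l. specialize (HK t). field; lra.
    + apply (is_lim_mult_infinity _ _ (/ (1 - N / 2))); [|apply HBK; lra|].
      * apply Rinv_0_lt_compat; lra.
      * apply (exp_asymptotic_lim_infinity K (1 - N / 2) c); trivial; lra.
  - intros Hm0. apply (lim_future_of_log _ _ _ HXe).
    apply (is_lim_ext _ _ _ _ Hfut).
    replace 0 with (2 / (2 - m) * 0) by ring.
    apply is_lim_mult_finite; trivial.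
    apply (exp_asymptotic_lim_0 (fun t => K (- t)) (m / 2 - 1) c'); trivial; lra.
  - intros Hm0. apply (lim_future_of_log _ _ _ HXe).
    apply (is_lim_ext _ _ _ _ Hfut).
    replace c' with (2 / (2 - m) * c') by (rewrite Hm0; field).
    apply is_lim_mult_finite; trivial.
    replace (- 1) with (m / 2 - 1) by (rewrite Hm0; field). apply Has'.
  - intros Hm0. apply (lim_future_of_log _ _ _ HXe).
    apply (is_lim_ext _ _ _ _ Hfut).
    apply (is_lim_mult_infinity _ _ (2 / (2 - m))); trivial.
    apply (exp_asymptotic_lim_infinity (fun t => K (- t)) (m / 2 - 1) c'); trivial; lra.
  - intros HN. apply (lim_origin_of_log _ _ _ HT), is_lim_minus_const_infinity.
    apply (primitive_ratio_infinity K B (1 - N / 2) c (B 0)); trivial; lra.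
  - intros HN. apply (lim_origin_of_log _ _ _ HT).
    replace (N / (2 - N)) with (/ (1 - N / 2) - 1) by (field; lra).
    now apply is_lim_minus_const, HBK.
  - apply (lim_future_of_log _ _ _ HT).
    replace (m / (2 - m)) with (2 / (2 - m) - 1) by (field; lra).
    now apply (is_lim_minus_const (fun t => B (- t) / K (- t))).
Qed.

(** * Finite exponential sums and their dominant term *)

Definition exp_sum (Omega n : nat -> R) (M : nat) (t : R) : R :=
  sum_n (fun i => Omega i * exp (n i * t)) M.

Lemma exp_sum_S (Omega n : nat -> R) (M : nat) (t : R) :
  exp_sum Omega n (S M) t = exp_sum Omega n M t + Omega (S M) * exp (n (S M) * t).
Proof. unfold exp_sum. now rewrite sum_Sn. Qed.

(** Reflection negates the exponents, so the smallest one becomes dominant. *)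
Lemma exp_sum_reflect (Omega n : nat -> R) (M : nat) (t : R) :
  exp_sum Omega n M (- t) = exp_sum Omega (fun i => - n i) M t.
Proof. apply sum_n_ext; intros i. do 2 f_equal; ring. Qed.

Lemma ex_derive_exp_sum (Omega n : nat -> R) (M : nat) (t : R) :
  ex_derive (exp_sum Omega n M) t.
Proof.
  induction M as [|M IH].
  - apply (ex_derive_ext (fun t => Omega 0%nat * exp (n 0%nat * t))).
    + intros; symmetry; apply sum_O.
    + auto_derive; trivial.
  - apply (ex_derive_ext (fun t => exp_sum Omega n M t + Omega (S M) * exp (n (S M) * t))).
    + intros; symmetry; apply exp_sum_S.
    + apply (ex_derive_plus (exp_sum Omega n M)); trivial. auto_derive; trivial.
Qed.

(** The strict inequality makes the other terms decay; it will come from extremality together with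
    distinctness of the exponents. *)
Definition dominant_exponent (Omega n : nat -> R) (i : nat) : Prop :=
  forall j, j <> i -> Omega j <> 0 -> n j < n i.

Lemma is_lim_dominated_term (Omega n : nat -> R) (i j : nat) :
  dominant_exponent Omega n i ->
  is_lim (fun t => Omega j * exp (n j * t) * exp (- (n i * t))) p_infty
    (Finite (if Nat.eq_dec j i then Omega i else 0)).
Proof.
  intros Hdom.
  apply (is_lim_ext (fun t => Omega j * exp ((n j - n i) * t))).
  - intros t. rewrite Rmult_assoc, <- exp_plus. do 2 f_equal; ring.
  - destruct (Nat.eq_dec j i) as [->|Hji].
    + apply (is_lim_ext (fun _ => Omega i)); [|apply is_lim_const].
      intros t. rewrite Rminus_diag, Rmult_0_l, exp_0. ring.
    + destruct (Req_dec (Omega j) 0) as [H0|H0].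
      * apply (is_lim_ext (fun _ => 0)); [|apply is_lim_const].
        intros t. rewrite H0. ring.
      * replace 0 with (Omega j * 0) by ring.
        apply is_lim_mult_finite; [apply is_lim_const|].
        apply is_lim_exp_scal_0. specialize (Hdom j Hji H0). lra.
Qed.

(** The conditional value lets the induction pass through truncations that do not yet contain the
    index [i]. *)
Lemma exp_sum_lim (Omega n : nat -> R) (i M : nat) :
  dominant_exponent Omega n i ->
  is_lim (fun t => exp_sum Omega n M t * exp (- (n i * t))) p_infty
    (Finite (if Compare_dec.le_dec i M then Omega i else 0)).
Proof.
  intros Hdom. induction M as [|M IH].
  - apply (is_lim_ext (fun t => Omega 0%nat * exp (n 0%nat * t) * exp (- (n i * t)))).
    + intros t. unfold exp_sum. now rewrite sum_O.
    + replace (if Compare_dec.le_dec i 0 then Omega i else 0)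
        with (if Nat.eq_dec 0 i then Omega i else 0)
        by (destruct (Compare_dec.le_dec i 0), (Nat.eq_dec 0 i); trivial; lia).
      now apply is_lim_dominated_term.
  - apply (is_lim_ext (fun t => exp_sum Omega n M t * exp (- (n i * t))
             + Omega (S M) * exp (n (S M) * t) * exp (- (n i * t)))).
    + intros t. rewrite exp_sum_S. ring.
    + replace (if Compare_dec.le_dec i (S M) then Omega i else 0)
        with ((if Compare_dec.le_dec i M then Omega i else 0)
              + (if Nat.eq_dec (S M) i then Omega i else 0))
        by (destruct (Compare_dec.le_dec i (S M)), (Compare_dec.le_dec i M),
              (Nat.eq_dec (S M) i); try lia; ring).
      apply is_lim_plus'; trivial. now apply is_lim_dominated_term.
Qed.

(** The inverse square root turns the rate [N] into [- N / 2], and [e^(b t)] shifts it by [b]. The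
    uses are [b = 1] at the origin and, after reflection, [b = -1] in the far future. *)
Lemma exp_asymptotic_inv_sqrt (s : R -> R) (H0 b N w : R) :
  0 < H0 -> (forall t, 0 < s t) -> w <> 0 ->
  is_lim (fun t => s t * exp (- (N * t))) p_infty w ->
  exp_asymptotic (fun t => exp (b * t) / (H0 * sqrt (s t))) (b - N / 2) (/ (H0 * sqrt w)).
Proof.
  intros HH0 Hs Hw Hlim.
  (* A limit of positive quantities is nonnegative; being nonzero, the dominant coefficient is
     positive although others may be negative. *)
  assert (Hwpos : 0 < w).
  { enough (0 <= w) by lra.
    apply (is_lim_le_loc (fun _ => 0) (fun t => s t * exp (- (N * t))) p_infty 0 w); trivial.
    - exists 0; intros t _. apply Rlt_le, Rmult_lt_0_compat; [apply Hs|apply exp_pos].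
    - apply is_lim_const. }
  assert (Hsw : 0 < H0 * sqrt w) by (apply Rmult_lt_0_compat; trivial; now apply sqrt_lt_R0).
  split; [now apply Rinv_0_lt_compat|].
  apply (is_lim_ext (fun t => / (H0 * sqrt (s t * exp (- (N * t)))))).
  - intros t. specialize (Hs t).
    (* Written as a square, the exponential can leave the root. *)
    replace (exp (- (N * t))) with (exp (- (N / 2 * t)) * exp (- (N / 2 * t)))
      by (rewrite <- exp_plus; f_equal; field).
    rewrite sqrt_mult, sqrt_square;
      try apply Rmult_le_pos; try apply Rlt_le; try apply exp_pos; trivial.
    replace (exp (- ((b - N / 2) * t))) with (exp (- (b * t)) * exp (N / 2 * t))
      by (rewrite <- exp_plus; f_equal; ring).
    rewrite !exp_Ropp.
    pose proof (exp_pos (N / 2 * t)). pose proof (exp_pos (b * t)).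
    pose proof (sqrt_lt_R0 _ Hs). field. repeat split; lra.
  - apply is_lim_inv_finite; [lra|].
    apply (is_lim_scal_l _ H0 p_infty (sqrt w)).
    apply (filterlim_comp _ _ _ (fun t => s t * exp (- (N * t))) sqrt _ (locally w)); trivial.
    apply continuous_sqrt.
Qed.

(** * Uniform convergence of the derivatives leaves finitely many components *)

Lemma is_derive_density_term (Omega n : nat -> R) (i : nat) (z : R) :
  -1 < z -> is_derive (fun z => density_term Omega n z i) z
    (Omega i * n i * exp ((n i - 1) * ln (1 + z))).
Proof.
  intros Hz. unfold density_term, Rpower.
  auto_derive; [lra|].
  replace ((n i - 1) * ln (1 + z)) with (n i * ln (1 + z) + - ln (1 + z)) by ring.
  rewrite exp_plus, exp_Ropp, exp_ln by lra. field; lra.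
Qed.

Lemma ex_derive_density_partial (Omega n : nat -> R) (k : nat) (z : R) :
  -1 < z -> ex_derive (density_partial Omega n k) z.
Proof.
  intros Hz. induction k as [|k IH].
  - apply (ex_derive_ext (fun z => density_term Omega n z 0)).
    + intros; symmetry; apply sum_O.
    + eexists; now apply is_derive_density_term.
  - apply (ex_derive_ext
      (fun z => density_partial Omega n k z + density_term Omega n z (S k))).
    + intros; unfold density_partial; now rewrite sum_Sn.
    + apply (ex_derive_plus (density_partial Omega n k)); trivial.
      eexists; now apply is_derive_density_term.
Qed.

(** At the [t] with [a t = C / |b|], the inequality [e^x >= 1 + x] gives
    [|b| e^(a t) >= |b| + C > C]. *)
Lemma exp_scal_unbounded (a b C : R) :
  a <> 0 -> b <> 0 -> ~ (forall t, Rabs (b * exp (a * t)) <= C).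
Proof.
  intros Ha Hb Hbound. specialize (Hbound (C / Rabs b / a)).
  replace (a * (C / Rabs b / a)) with (C / Rabs b) in Hbound
    by (field; split; trivial; now apply Rabs_no_R0).
  rewrite Rabs_mult, (Rabs_right (exp _)) in Hbound by (apply Rle_ge, Rlt_le, exp_pos).
  pose proof (exp_ineq1_le (C / Rabs b)).
  assert (Hpos := Rabs_pos_lt b Hb).
  apply (Rmult_le_compat_l (Rabs b)) in H; [|lra].
  replace (Rabs b * (1 + C / Rabs b)) with (Rabs b + C) in H by (field; lra). lra.
Qed.

(** Tolerance 1 keeps consecutive derivatives within 2 of each other at every [z], whereas their
    difference is unbounded unless the coefficient [Omega i * n i] or the rate [n i - 1]
    vanishes. *)
Lemma eventually_exponent_0_or_1 (Omega n : nat -> R) (G : R -> R) :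
  converges_uniformly_on (fun z => -1 < z) (fun k => Derive (density_partial Omega n k)) G ->
  exists M, forall i, (M < i)%nat -> Omega i <> 0 -> n i = 0 \/ n i = 1.
Proof.
  intros Hcvu. destruct (Hcvu (mkposreal 1 Rlt_0_1)) as [M HM]; simpl in HM.
  exists M; intros i Hi HO.
  apply NNPP; intros Hn; apply not_or_and in Hn; destruct Hn as [Hn0 Hn1].
  apply (exp_scal_unbounded (n i - 1) (Omega i * n i) 2);
    [lra|now apply Rmult_integral_contrapositive|].
  (* This [z] realises an arbitrary real [t] as [ln (1 + z)] inside the domain. *)
  intros t. set (z := exp t - 1).
  assert (Hz : -1 < z) by (unfold z; pose proof (exp_pos t); lra).
  assert (Ht : ln (1 + z) = t) by (unfold z; rewrite Rplus_minus; apply ln_exp).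
  destruct i as [|k]; [lia|].
  (* From [M < S k] both [k] and [S k] are at least [M], so both bounds are available. *)
  assert (H1 := HM k ltac:(lia) z Hz). assert (H2 := HM (S k) ltac:(lia) z Hz).
  assert (Heq : Derive (density_partial Omega n (S k)) z =
    Derive (density_partial Omega n k) z
    + Omega (S k) * n (S k) * exp ((n (S k) - 1) * t)).
  { rewrite (Derive_ext _
      (fun z => density_partial Omega n k z + density_term Omega n z (S k)))
      by (intros; unfold density_partial; now rewrite sum_Sn).
    rewrite Derive_plus.
    - f_equal. rewrite <- Ht. now apply is_derive_unique, is_derive_density_term.
    - now apply ex_derive_density_partial.
    - eexists; now apply is_derive_density_term. }
  rewrite Heq in H2. apply Rabs_def2 in H1, H2. apply Rabs_le. lra.
Qed.

Lemma eventually_of_unique (P : nat -> Prop) :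
  (forall i j, P i -> P j -> i = j) -> exists M, forall i, (M < i)%nat -> ~ P i.
Proof.
  intros Hu. destruct (classic (exists i, P i)) as [[i Hi]|Hno].
  - exists i; intros j Hj HPj. specialize (Hu i j Hi HPj). lia.
  - exists 0%nat; intros j _ HPj. apply Hno; now exists j.
Qed.

(** Distinctness allows at most one present component with exponent 0 and one with exponent 1. *)
Lemma finitely_many_components (Omega n : nat -> R) (G : R -> R) :
  distinct_exponents Omega n ->
  converges_uniformly_on (fun z => -1 < z) (fun k => Derive (density_partial Omega n k)) G ->
  exists M, forall i, (M < i)%nat -> Omega i = 0.
Proof.
  intros Hdist Hcvu. destruct (eventually_exponent_0_or_1 Omega n G Hcvu) as [M1 HM1].
  assert (Hu : forall a, exists M, forall i, (M < i)%nat -> ~ (Omega i <> 0 /\ n i = a)).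
  { intros a. apply eventually_of_unique. intros i j [Hi Hia] [Hj Hja].
    apply Hdist; trivial. congruence. }
  destruct (Hu 0) as [M2 HM2]. destruct (Hu 1) as [M3 HM3].
  exists (M1 + M2 + M3)%nat; intros i Hi. apply NNPP; intros HO.
  destruct (HM1 i ltac:(lia) HO) as [Hn|Hn].
  - now apply (HM2 i); [lia|].
  - now apply (HM3 i); [lia|].
Qed.

(** * The density as a finite exponential sum *)

Lemma Series_finite (a : nat -> R) (M : nat) :
  (forall i, (M < i)%nat -> a i = 0) -> Series a = sum_n a M.
Proof.
  intros Ha. apply is_series_unique.
  apply (is_lim_seq_ext_loc (fun _ => sum_n a M) (sum_n a) (sum_n a M));
    [|apply is_lim_seq_const].
  exists M; intros k Hk. induction Hk as [|k Hk IH]; trivial.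
  rewrite sum_Sn, <- IH, Ha by lia. symmetry; apply Rplus_0_r.
Qed.

(** [Rpower (1 + z) a] unfolds to [exp (a * ln (1 + z))], so the truncated sum is [exp_sum] by
    conversion. *)
Lemma density_exp_sum (Omega n : nat -> R) (M : nat) (z : R) :
  (forall i, (M < i)%nat -> Omega i = 0) ->
  density Omega n z = exp_sum Omega n M (ln (1 + z)).
Proof.
  intros HM. apply Series_finite. intros i Hi. unfold density_term.
  rewrite HM by trivial. apply Rmult_0_l.
Qed.

Theorem mainTheorem2
  (H0 : R) (Omega n : nat -> R) (G : R -> R) (iN im : nat)
  (H0_pos : 0 < H0)
  (Omega_sum : is_series Omega 1)
  (n_distinct : distinct_exponents Omega n)
  (S'_cvu : converges_uniformly_on (fun z => -1 < z)
              (fun k => Derive (density_partial Omega n k)) G)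
  (expanding : forall z, -1 < z -> 0 < density Omega n z)
  (iN_largest : largest_exponent_at Omega n iN)
  (im_smallest : smallest_exponent_at Omega n im) :
  let H := hubble H0 Omega n in
  let N := n iN in
  let m := n im in
  let Hp := particle_horizon H in
  let He := event_horizon H in
  (2 < N ->
    (forall z, -1 < z -> particle_horizon_finite H z /\ ex_derive Hp z) /\
    lim_origin Hp 0 /\
    lim_future Hp p_infty /\
    lim_origin (time_derivative H Hp) (N / (N - 2)) /\
    (m <= 2 -> lim_future (time_derivative H Hp) p_infty) /\
    (2 < m -> lim_future (time_derivative H Hp) (m / (m - 2))))
  /\
  (m < 2 ->
    (forall z, -1 < z -> event_horizon_finite H z /\ ex_derive He z) /\
    (0 < N -> lim_origin He 0) /\
    (N = 0 -> lim_origin He (/ (H0 * sqrt (Omega iN)))) /\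
    (N < 0 -> lim_origin He p_infty) /\
    (m < 0 -> lim_future He 0) /\
    (m = 0 -> lim_future He (/ (H0 * sqrt (Omega im)))) /\
    (0 < m -> lim_future He p_infty) /\
    (2 <= N -> lim_origin (time_derivative H He) p_infty) /\
    (N < 2 -> lim_origin (time_derivative H He) (N / (2 - N))) /\
    lim_future (time_derivative H He) (m / (2 - m))).
Proof.
  intros H N m Hp He.
  destruct (finitely_many_components Omega n G n_distinct S'_cvu) as [M HM].
  destruct iN_largest as [HON HNmax]. destruct im_smallest as [HOm Hmmin].
  assert (Hle : forall i, Omega i <> 0 -> (i <= M)%nat).
  { intros i Hi. destruct (Nat.le_gt_cases i M) as [|Hlt]; trivial.
    now specialize (HM i Hlt). }
  set (s := exp_sum Omega n M).
  assert (Hs : forall t, 0 < s t).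
  (* Writing [t = ln (1 + (e^t - 1))] turns expansion at [z = e^t - 1] into positivity at every
     [t]. *)
  { intros t. rewrite <- (ln_exp t), <- (Rplus_minus 1 (exp t)).
    unfold s. rewrite <- density_exp_sum by trivial.
    apply expanding. pose proof (exp_pos t); lra. }
  assert (HlimN : is_lim (fun t => s t * exp (- (N * t))) p_infty (Omega iN)).
  { pose proof (exp_sum_lim Omega n iN M) as Hlim.
    destruct (Compare_dec.le_dec iN M) as [_|Hn]; [|now elim Hn; apply Hle].
    (* An equal exponent would force [j = iN] by distinctness, so the maximum is strict. *)
    apply Hlim. intros j Hj HOj. destruct (HNmax j HOj) as [|Heq]; trivial.
    now elim Hj; apply n_distinct. }
  assert (Hlimm : is_lim (fun t => s (- t) * exp (- (- m * t))) p_infty (Omega im)).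
  { pose proof (exp_sum_lim Omega (fun i => - n i) im M) as Hlim.
    destruct (Compare_dec.le_dec im M) as [_|Hn]; [|now elim Hn; apply Hle].
    refine (is_lim_ext _ _ _ _ _ (Hlim _)).
    - intros t. unfold s. now rewrite exp_sum_reflect.
    - intros j Hj HOj. destruct (Hmmin j HOj) as [|Heq]; [lra|].
      now elim Hj; apply n_distinct. }
  (* This is [(1 + z) / H] at [1 + z = e^t], with [1 * t] matching the parameter [b = 1] of
     [exp_asymptotic_inv_sqrt]. *)
  set (K := fun t => exp (1 * t) / (H0 * sqrt (s t))).
  assert (HsH : forall t, 0 < H0 * sqrt (s t))
    by (intros; apply Rmult_lt_0_compat; trivial; now apply sqrt_lt_R0).
  assert (HHK : log_density H K).
  { split; [|split].
    - intros t. apply Rdiv_lt_0_compat; trivial. apply exp_pos.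
    - intros t. apply (ex_derive_continuous K). unfold K. specialize (HsH t).
      auto_derive. repeat split; trivial; [apply ex_derive_exp_sum|lra].
    - intros z Hz. unfold K, H, hubble, s.
      rewrite Rmult_1_l, exp_log_shift, (density_exp_sum Omega n M) by trivial.
      fold s. specialize (HsH (ln (1 + z))).
      pose proof (Rmult_integral_contrapositive H0 (sqrt (s (ln (1 + z))))).
      field. repeat split; try lra.
      apply Rgt_not_eq, sqrt_lt_R0, Hs. }
  assert (HasN : exp_asymptotic K (1 - N / 2) (/ (H0 * sqrt (Omega iN)))).
  { now apply exp_asymptotic_inv_sqrt. }
  assert (Hasm : exp_asymptotic (fun t => K (- t)) (m / 2 - 1) (/ (H0 * sqrt (Omega im)))).
  (* With [b = -1] and rate [- m] the resulting exponent is [-1 + m / 2], the rate of [K (- t)]. *)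
  { destruct (exp_asymptotic_inv_sqrt (fun t => s (- t)) H0 (- 1) (- m) (Omega im))
      as [Hc Hlim]; trivial.
    split; trivial. refine (is_lim_ext _ _ _ _ _ Hlim).
    intros t. unfold K. do 3 f_equal; field. }
  split.
  - now apply (particle_horizon_limits H K N m _ _ HHK HasN Hasm).
  - now apply (event_horizon_limits H K N m _ _ HHK HasN Hasm).
Qed.
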